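(* Suppose that $(\mathcal{A},\varphi,\varphi')$ is an infinitesimal non-commutative probability space, and $a,a_1,a_2,\dots$ is a sequence of identically distributed elements of $\mathcal{A}$ which are infinitesimally independent (free, Boolean or monotone). Assume also that $\varphi(a)=\varphi'(a)=0$, $\varphi(a^2)=1$ and $\varphi'(a^2)=\alpha$. Let $G$ be the Cauchy transform and $g$ the infinitesimal Cauchy transform of the limit law of $S_N=(a_1+\cdots+a_N)/\sqrt N$ with respect to $(\varphi,\varphi')$. Then $$g(z)=\frac{-\alpha}{2}\frac{d}{dz}\big(zG(z)\big).$$
   Context: An infinitesimal non-commutative probability space $(\mathcal{A},\varphi,\varphi')$ is a unital complex algebra with linear functionals $\varphi,\varphi'$ such that $\varphi(1)=1$, $\varphi'(1)=0$. Identically distributed: $\varphi(a_i^k)=\varphi(a^k)$ and $\varphi'(a_i^k)=\varphi'(a^k)$ for all $i,k$. The limit law is given by $m_n=\lim_N\varphi(S_N^n)$, $m'_n=\lim_N\varphi'(S_N^n)$, and $G(z)=\sum_{n\ge0}m_nz^{-n-1}$, $g(z)=\sum_{n\ge1}m_n'z^{-n-1}$. The sequence $(a_i)_{i\ge1}$ is infinitesimally independent if the unital algebras $\mathcal{A}_i=\mathrm{alg}(1,a_i)$ generated by the $a_i$ are so, in one of the following three senses. (Free) For $i_1\ne i_2\ne\cdots\ne i_n$ (consecutive indices distinct), $c_j\in\mathcal{A}_{i_j}$, $\varphi(c_j)=0$: $\varphi(c_1\cdots c_n)=0$ and $\varphi'(c_1\cdots c_n)=\sum_j\varphi'(c_j)\varphi(c_1\cdots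 c_{j-1}c_{j+1}\cdots c_n)$. (Boolean) For $i_1\ne\cdots\ne i_n$, $c_j\in\mathcal{A}_{i_j}$: $\varphi(c_1\cdots c_n)=\prod_j\varphi(c_j)$ and $\varphi'(c_1\cdots c_n)=\sum_j\varphi'(c_j)\prod_{k\ne j}\varphi(c_k)$. (Monotone) For $c_k\in\mathcal{A}_{i_k}$ and $j$ with $i_{j-1}<i_j>i_{j+1}$ (one inequality eliminated if $j=1$ or $j=n$): $\varphi(c_1\cdots c_n)=\varphi(c_j)\varphi(c_1\cdots c_{j-1}c_{j+1}\cdots c_n)$ and $\varphi'(c_1\cdots c_n)=\varphi'(c_j)\varphi(c_1\cdots c_{j-1}c_{j+1}\cdots c_n)+\varphi(c_j)\varphi'(c_1\cdots c_{j-1}c_{j+1}\cdots c_n)$. *)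

(* Defs.v *)
From HB Require Import structures.
From mathcomp Require Import all_boot all_order all_algebra.
From mathcomp Require Import complex.
From mathcomp Require Import boolp classical_sets reals topology normedtype.
From mathcomp Require Import sequences derive.

Set Implicit Arguments.
Unset Strict Implicit.
Unset Printing Implicit Defensive.

Import Order.TTheory GRing.Theory Num.Theory.
Import numFieldNormedType.Exports.

Local Open Scope ring_scope.
Local Open Scope classical_set_scope.

(* Topological notions on the complex numbers R[i] are taken on the regular
   module R[i]^o, which is where the library puts the normed-module structure
   of a concrete numFieldType; R[i]^o is convertible to R[i]. *)

Section Independence.
Variables (R : realType) (A : algType R[i]).
Implicit Types (phi : {scalar A}) (B : nat -> set A).

(* alg(1, x): all polynomials in x. *)
Definition unital_alg (x : A) : set A :=
  [set c | exists p : {poly R[i]}, c = horner_alg x p].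

(* alg(x): polynomials in x without constant term. *)
Definition nonunital_alg (x : A) : set A :=
  [set c | exists2 p : {poly R[i]}, p`_0 = 0 & c = horner_alg x p].

Definition alternating n (i : 'I_n -> nat) : Prop :=
  forall j k : 'I_n, k = j.+1 :> nat -> i j <> i k.

Definition peak n (i : 'I_n -> nat) (j : 'I_n) : Prop :=
  forall k : 'I_n, (k.+1 == j) || (j.+1 == k) -> (i k < i j)%N.

(* In the three definitions below B k plays the role of the k-th algebra, and
   products over 'I_n are taken in increasing order of the index. *)

Definition inf_free phi phi' B : Prop :=
  forall n (i : 'I_n -> nat) (c : 'I_n -> A), (0 < n)%N ->
    alternating i -> (forall j, B (i j) (c j)) -> (forall j, phi (c j) = 0) ->
    phi (\prod_(j < n) c j) = 0 /\
    phi' (\prod_(j < n) c j) =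
      \sum_(j < n) phi' (c j) * phi (\prod_(k < n | k != j) c k).

Definition inf_boolean phi phi' B : Prop :=
  forall n (i : 'I_n -> nat) (c : 'I_n -> A), (0 < n)%N ->
    alternating i -> (forall j, B (i j) (c j)) ->
    phi (\prod_(j < n) c j) = \prod_(j < n) phi (c j) /\
    phi' (\prod_(j < n) c j) =
      \sum_(j < n) phi' (c j) * \prod_(k < n | k != j) phi (c k).

Definition inf_monotone phi phi' B : Prop :=
  forall n (i : 'I_n -> nat) (c : 'I_n -> A) (j : 'I_n),
    (forall k, B (i k) (c k)) -> peak i j ->
    phi (\prod_(k < n) c k) = phi (c j) * phi (\prod_(k < n | k != j) c k) /\
    phi' (\prod_(k < n) c k) =
      phi' (c j) * phi (\prod_(k < n | k != j) c k) +
      phi (c j) * phi' (\prod_(k < n | k != j) c k).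

(* For Boolean and monotone independence the algebras generated by the
   variables must not contain the unit.  If 1 is allowed in every algebra, the
   Boolean rule applied to x * 1 * x (indices i, j, i with i != j), and the
   monotone rule applied to the same word with j < i, force
   phi (x ^+ 2) = phi x ^+ 2, so that no sequence of centred variables of
   variance 1 is independent.  Independence of the unital algebras implies
   independence of the non-unital ones. *)
Definition inf_independent phi phi' (a_ : nat -> A) : Prop :=
  [\/ inf_free phi phi' (fun i => unital_alg (a_ i)),
      inf_boolean phi phi' (fun i => nonunital_alg (a_ i)) |
      inf_monotone phi phi' (fun i => nonunital_alg (a_ i))].

Definition identically_distributed phi phi' (a : A) (a_ : nat -> A) : Prop :=
  forall i k, phi (a_ i ^+ k) = phi (a ^+ k) /\ phi' (a_ i ^+ k) = phi' (a ^+ k).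

(* (a_1 + ... + a_N) / sqrt N, the sequence being indexed from 0. *)
Definition clt_sum (a_ : nat -> A) (N : nat) : A :=
  (sqrtC (N%:R : R[i]))^-1 *: \sum_(i < N) a_ i.

Definition clt_moment phi (a_ : nat -> A) (n N : nat) : R[i]^o :=
  phi (clt_sum a_ N ^+ n).

Definition limit_moment phi (a_ : nat -> A) (n : nat) : R[i]^o :=
  limn (clt_moment phi a_ n).

End Independence.

Section CauchyTransform.
Variable R : realType.
Implicit Types (m : nat -> R[i]) (z : R[i]).

Definition cauchy_partial m z (N : nat) : R[i]^o :=
  \sum_(0 <= n < N) m n / z ^+ n.+1.

Definition cauchy_transform m z : R[i]^o := limn (cauchy_partial m z).

Definition inf_cauchy_partial m' z (N : nat) : R[i]^o :=
  \sum_(1 <= n < N) m' n / z ^+ n.+1.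

Definition inf_cauchy_transform m' z : R[i]^o := limn (inf_cauchy_partial m' z).

End CauchyTransform.

(* Main.v *)
(* The limit law only sees words in which every letter occurs exactly twice: a
   word with a letter occurring once has phi = phi' = 0 for all three notions of
   independence, and words with fewer than n/2 distinct letters are too few to
   survive the normalisation N^(-n/2).  On a word of n letters, each occurring
   twice, either phi and phi' both vanish, or the word can be erased by deleting
   adjacent equal pairs x x; each deletion multiplies phi by phi(a^2) = 1 and
   adds alpha phi to phi', so phi = 1 and phi' = (n/2) alpha.  Hence
   m'_n = (alpha n / 2) m_n, which is the coefficientwise form of the claim.
   Counting the erasable words with a stack machine gives |m_n| <= 4^n, so all
   the series converge, and zG(z) may be differentiated termwise, for |z| > 16. *)

Require Import Defs.
From HB Require Import structures.
From mathcomp Require Import all_boot all_order all_algebra.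
From mathcomp Require Import complex.
From mathcomp Require Import boolp classical_sets reals topology normedtype.
From mathcomp Require Import sequences derive.
From mathcomp Require Import zify ring.

Set Implicit Arguments.
Unset Strict Implicit.
Unset Printing Implicit Defensive.

Import Order.TTheory GRing.Theory Num.Theory.
Import numFieldNormedType.Exports.

Local Open Scope ring_scope.

(** * Words and the stack machine *)

(** This is reduction in the free product of copies of Z/2, each letter being an involution. Started
    from the empty stack, it holds the reduced form of the prefix read so far, last letter first. *)
Definition stack_push (s : seq nat) (x : nat) : seq nat :=
  if s is y :: s' then (if y == x then s' else x :: s) else [:: x].

Definition reduces_to_nil (s w : seq nat) : bool :=
  foldl stack_push s w == [::].

Definition stack_reduced (s : seq nat) : bool := sorted (fun x y => x != y) s.

Lemma stack_push_reduced s x : stack_reduced s -> stack_reduced (stack_push s x).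
Proof.
case: s => [|y s] //=; rewrite /stack_reduced.
case: (eqVneq y x) => [_ /path_sorted //|yx] /= ->.
by rewrite eq_sym yx.
Qed.

Lemma foldl_stack_push_reduced w s :
  stack_reduced s -> stack_reduced (foldl stack_push s w).
Proof. by elim: w s => [|x w IHw] s //= /(stack_push_reduced x)/IHw. Qed.

(** Reducedness matters: on [x :: x :: s] two pushes of [x] would delete both letters. *)
Lemma stack_pushK s x :
  stack_reduced s -> stack_push (stack_push s x) x = s.
Proof.
case: s => [|y s] /=; first by rewrite eqxx.
rewrite /stack_reduced; case: (eqVneq y x) => [->|yx] /=; last by rewrite eqxx.
by case: s => [|z s] //= /andP[xz _]; rewrite eq_sym (negbTE xz).
Qed.

Lemma reduces_to_nil_insert u x v :
  reduces_to_nil [::] (u ++ x :: x :: v) = reduces_to_nil [::] (u ++ v).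
Proof.
by rewrite /reduces_to_nil !foldl_cat /= stack_pushK// foldl_stack_push_reduced.
Qed.

Section TupleSums.
Variables (V : nmodType) (N : nat).

Lemma big_tuple0 (F : seq 'I_N -> V) : \sum_(t : 0.-tuple 'I_N) F t = F [::].
Proof.
by rewrite (big_pred1 [tuple]) => [//|t]; rewrite /= -val_eqE /= [t]tuple0 eqxx.
Qed.

Lemma big_tuple_cons n (F : seq 'I_N -> V) :
  \sum_(t : n.+1.-tuple 'I_N) F t =
  \sum_(x < N) \sum_(t : n.-tuple 'I_N) F (x :: t).
Proof.
rewrite pair_big /= (reindex (fun p : 'I_N * n.-tuple 'I_N => cons_tuple p.1 p.2)) //.
exists (fun t => (thead t, behead_tuple t)) => [[x t] _ | t _] /=.
  by rewrite theadE; congr pair; apply: val_inj.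
by rewrite [RHS]tuple_eta; apply: val_inj.
Qed.

End TupleSums.

Definition word N (t : seq 'I_N) : seq nat := map val t.

Lemma exp_sum_words (A : pzRingType) (a_ : nat -> A) N n :
  (\sum_(i < N) a_ i) ^+ n =
  \sum_(t : n.-tuple 'I_N) \prod_(i <- word t) a_ i.
Proof.
elim: n => [|n IHn].
  by rewrite expr0 (big_tuple0 (fun t => \prod_(i <- word t) a_ i)) big_nil.
rewrite exprS IHn (big_tuple_cons _ (fun t => \prod_(i <- word t) a_ i)) mulr_suml.
apply: eq_bigr => x _; rewrite mulr_sumr; apply: eq_bigr => t _.
by rewrite big_cons.
Qed.

(* A step of the stack machine either opens a pair (N choices of the letter) or
   closes the pair on the top of the stack (no choice). *)
Lemma count_reducing_words N n j s : (0 < N)%N -> (n <= size s + j.*2)%N ->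
  (\sum_(t : n.-tuple 'I_N) reduces_to_nil s (word t) <= 2 ^ n * N ^ j)%N.
Proof.
move=> N0.
(* One letter lowers the stack by at most one, so a word shorter than the stack cannot empty it. *)
have short m s' : (m < size s')%N ->
    (\sum_(t : m.-tuple 'I_N) reduces_to_nil s' (word t) = 0)%N.
  move=> ms; apply: big1 => t _; apply/eqP; rewrite eqb0 /reduces_to_nil.
  suff: (0 < size (foldl stack_push s' (word t)))%N by case: foldl.
  have {ms} : (size (word t) < size s')%N by rewrite size_map size_tuple.
  elim: (word t) s' => [|x w IHw] //= s' ws; apply: IHw.
  case: s' ws => [|y s'] //=; rewrite ltnS => ws.
  by case: (y == x) => //=; lia.
elim: n j s => [|n IHn] j s njs.
  rewrite (big_tuple0 (V := nat) (N := N) (fun t => reduces_to_nil s (word t) : nat)).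
  by rewrite expn0 mul1n (leq_trans (leq_b1 _))// expn_gt0 N0.
rewrite (big_tuple_cons (V := nat) _ (fun t => reduces_to_nil s (word t) : nat)).
(* [B] bounds the completions after an opening step. For [j = 0] there are none: the grown stack is
   longer than the remaining word. *)
pose B := (if j is j'.+1 then 2 ^ n * N ^ j' else 0)%N.
have NB : (N * B <= 2 ^ n * N ^ j)%N.
  by rewrite /B; case: j {njs B} => [|j]; rewrite ?muln0// expnS mulnCA.
have push_le x : (\sum_(t : n.-tuple 'I_N) reduces_to_nil (x :: s) (word t) <= B)%N.
  rewrite /B; case: j {NB B} njs => [|j] njs; last by apply: IHn => /=; lia.
  by rewrite short//= ; lia.
rewrite expnS mul2n -addnn mulnDl.
case: s njs push_le => [|y s] njs push_le.
  rewrite (leq_trans _ (leq_addl _ _))// (leq_trans _ NB)//.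
  rewrite -[X in (_ <= X * _)%N]card_ord -sum_nat_const leq_sum// => x _.
  exact: push_le.
apply: leq_trans (leq_add (leqnn _) NB).
rewrite -[X in (_ <= _ + X * _)%N]card_ord -sum_nat_const.
(* At most one letter, the top [y] of the stack, closes a pair; it is charged [2 ^ n * N ^ j]. Every
   other letter opens one and is charged [B]. *)
apply: (@leq_trans (\sum_(x < N | y == x) 2 ^ n * N ^ j + \sum_(x < N) B)); last first.
  rewrite leq_add2r sum_nat_const -[X in (_ <= X)%N]mul1n leq_mul2r; apply/orP; right.
  by apply/card_le1_eqP => x z /eqP yx /eqP yz; apply: val_inj; rewrite /= -yx.
rewrite [X in (_ <= X + _)%N]big_mkcond /= -big_split /=; apply: leq_sum => x _.
rewrite /reduces_to_nil /=; case: eqP => [_|_]; last exact: push_le.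
by apply: leq_trans (leq_addr _ _); apply: IHn; move: njs => /=; lia.
Qed.

(** The falling factorial of [2k] of length [k] is at least [k ^ k], and equals ['C(2k, k) * k!]
    with ['C(2k, k) <= 2 ^ (2k)]. This offsets the [k ^ k] choices of letters against the [k!] of
    the limit. *)
Lemma expnn_le_fact k : (k ^ k <= 4 ^ k * k`!)%N.
Proof.
have le_ffact m : (forall n, n ^ m <= (n + m) ^_ m)%N.
  elim: m => [//|m IHm] n; rewrite expnSr addnS ffactnS /=.
  by rewrite mulnC leq_mul//; lia.
apply: leq_trans (le_ffact k k) _; rewrite addnn -bin_ffact leq_mul2r.
apply/orP; right.
have -> : (4 ^ k = 2 ^ k.*2)%N by rewrite -mul2n expnM.
rewrite -[2%N]/(1 + 1)%N (expnDn 1 1) (bigD1 (inord k)) //= inordK; last by lia.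
by rewrite !exp1n !muln1 leq_addr.
Qed.

(** * Sums over words *)

Lemma homo_ltn_inj (f : nat -> nat) :
  {homo f : x y / (x < y)%N} -> injective f.
Proof.
by move=> f_incr x y fxy; case: (ltngtP x y) => // /f_incr; rewrite fxy ltnn.
Qed.

(** Only increasing relabellings are allowed, because monotone independence depends on the order of
    the indices. *)
Definition spreadable (V : Type) (F : seq nat -> V) : Prop :=
  forall (f : nat -> nat) w, {homo f : x y / (x < y)%N} -> F (map f w) = F w.

Definition onto_sum (V : nmodType) (F : seq nat -> V) (n k : nat) : V :=
  \sum_(t : n.-tuple 'I_k | [forall x, x \in t]) F (word t).

Lemma sum_count_mem (T : finType) (s : seq T) :
  (\sum_x count_mem x s)%N = size s.
Proof.
elim: s => [|y s IHs] /=; first exact: big1.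
by rewrite big_split /= IHs (bigD1 y) //= eqxx big1 // => x /negbTE; rewrite eq_sym => ->.
Qed.

(** Pigeonhole: the [k] multiplicities are positive with sum [n <= 2k]. If none is 1, all are at
    least 2, and the sum forces equality everywhere. *)
Lemma onto_tuple_dichotomy n k (t : n.-tuple 'I_k) :
  (n <= k.*2)%N -> [forall x, x \in t] ->
  (exists x, count_mem x (word t) = 1%N) \/
  (n = k.*2 /\ forall x, x \in word t -> count_mem x (word t) = 2).
Proof.
move=> nk /forallP onto.
have cE x : count_mem (val x) (word t) = count_mem x t.
  by rewrite count_map; apply: eq_count => y /=; rewrite val_eqE.
case: (pickP [pred x | count_mem x t == 1%N]) => [x /= /eqP x1 | no1].
  by left; exists (val x); rewrite cE.
right.
have ge2 x : xpredT x -> (2 <= count_mem x t ?= iff (count_mem x t == 2))%N.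
  move=> _; split; last by rewrite eq_sym.
  have c0 : (0 < count_mem x t)%N by rewrite -has_count has_pred1.
  have /= /eqP := no1 x; by case: (count_mem x t) c0 => [|[|]].
have := leqif_sum ge2; rewrite sum_count_mem size_tuple sum_nat_const card_ord.
move=> [kn kE]; have nE : n = k.*2 by apply/eqP; rewrite eqn_leq nk; lia.
split=> // y /mapP[x xt ->]; rewrite cE; apply/eqP.
have /forallP/(_ x) // : [forall i, count_mem i t == 2].
by rewrite -kE; apply/eqP; lia.
Qed.

Lemma onto_sum_eq0 (V : nmodType) (F : seq nat -> V) n k :
  (n < k)%N -> onto_sum F n k = 0.
Proof.
move=> nk; rewrite /onto_sum big_pred0 // => t; apply/negbTE/negP => /forallP onto.
suff: (k <= n)%N by rewrite leqNgt nk.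
rewrite -[X in (X <= _)%N]card_ord -(size_tuple t) -sum_count_mem -sum1_card.
by apply: leq_sum => x _; rewrite -has_count has_pred1.
Qed.

Lemma increasing_enum N (S : {set 'I_N}) : exists2 f : nat -> nat,
  {homo f : x y / (x < y)%N} & forall x : 'I_#|S|, f x = enum_val x.
Proof.
pose s := map val (enum S).
have s_size : size s = #|S| by rewrite size_map -cardE.
have s_sorted : sorted ltn s.
  rewrite /s {1}/enum_mem -enumT /= sorted_map.
  apply: sorted_filter; first by move=> x y z; apply: ltn_trans.
  by rewrite -sorted_map val_enum_ord iota_ltn_sorted.
(* Past [#|S|] the values [N + j] exceed every element of ['I_N], so the function increases on all
   of [nat], as [spreadable] requires. *)
exists (fun j => if (j < #|S|)%N then nth 0%N s j else (N + j)%N); last first.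
  move=> x; rewrite ltn_ord (nth_map (enum_val x)) -?cardE//.
  by rewrite -enum_val_nth.
move=> x y xy; case: ifP => xS; case: ifP => yS.
- by apply: (sorted_ltn_nth ltn_trans); rewrite ?inE ?s_size.
- have: nth 0%N s x \in s by rewrite mem_nth ?s_size.
  by move=> /mapP[z _ ->]; have := ltn_ord z; rewrite /=; lia.
- lia.
- lia.
Qed.

Lemma map_enum_valP N (S : {set 'I_N}) (s : seq 'I_N) :
  {subset s <= S} -> exists t : seq 'I_#|S|, s = map enum_val t.
Proof.
elim: s => [|x s IHs] sS; first by exists [::].
have [|t ->] := IHs; first by move=> y ys; apply: sS; rewrite inE ys orbT.
have xS : x \in S by apply: sS; rewrite inE eqxx.
by exists (enum_rank_in xS x :: t); rewrite /= enum_rankK_in.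
Qed.

(** Words are grouped by their set [S] of letters. The increasing bijection from ['I_#|S|] to [S]
    turns each group into [onto_sum F n #|S|], and there are ['C(N, k)] sets of size [k]. *)
Lemma sum_words_by_letters (V : nmodType) (F : seq nat -> V) N n :
  spreadable F ->
  \sum_(t : n.-tuple 'I_N) F (word t) =
  \sum_(k < n.+1) onto_sum F n k *+ 'C(N, k).
Proof.
move=> F_spread.
rewrite (partition_big (fun t : n.-tuple 'I_N => [set x in t]) xpredT) //=.
have letters (S : {set 'I_N}) :
    \sum_(t : n.-tuple 'I_N | [set x in t] == S) F (word t) = onto_sum F n #|S|.
  have [f f_incr fE] := increasing_enum S.
  have h_inj : injective (fun t : n.-tuple 'I_#|S| => map_tuple enum_val t).
    move=> t1 t2 /(congr1 val) /= /(inj_map enum_val_inj) E; exact: val_inj.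
  transitivity (\sum_(t in [set map_tuple enum_val t | t : n.-tuple 'I_#|S| &
       [forall x, x \in t]]) F (word t)).
    apply: eq_bigl => t; apply/eqP/imsetP => [tS | [u uS ->]].
      have [|u tE] := @map_enum_valP N S t.
        by move=> x xt; rewrite -tS inE.
      have u_size : size u == n by rewrite -(size_map enum_val) -tE size_tuple.
      exists (Tuple u_size); last exact: val_inj.
      rewrite inE; apply/forallP => x.
      have : enum_val x \in [set y in t] by rewrite tS enum_valP.
      rewrite inE => xt; have : enum_val x \in map enum_val u by rewrite -tE.
      by rewrite mem_map //; exact: enum_val_inj.
    move: uS; rewrite inE => /forallP uS.
    apply/setP => x; rewrite inE /=; apply/mapP/idP => [[y _ ->] | xS].
      exact: enum_valP.
    by exists (enum_rank_in xS x); rewrite ?enum_rankK_in //; exact: uS.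
  rewrite big_imset /=; last by move=> t1 t2 _ _ /h_inj.
  apply: eq_big => [t|t _]; first by rewrite inE.
  rewrite -(F_spread f (word t)) //; congr F.
  rewrite /word /= -!map_comp; apply: eq_map => x /=.
  by rewrite fE.
under eq_bigr do rewrite letters.
transitivity (\sum_(S : {set 'I_N}) \sum_(k < n.+1 | #|S| == k) onto_sum F n k).
  apply: eq_bigr => S _; have [nS | Sn] := ltnP n #|S|.
    rewrite onto_sum_eq0 // big1 // => k /eqP kS.
    by apply: onto_sum_eq0; rewrite -kS.
  rewrite (big_pred1 (Ordinal (Sn : #|S| < n.+1)%N)) //.
rewrite (exchange_big_dep xpredT) //=; apply: eq_bigr => k _.
rewrite sumr_const -[in RHS](card_ord N) -card_draws; congr (_ *+ _).
by apply: eq_card => S; rewrite !inE.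
Qed.

(** * Pair words and their evaluation by deletion *)

Definition pair_word (w : seq nat) : Prop :=
  forall x, x \in w -> count_mem x w = 2.

(* [p] and [q] are phi and phi' evaluated on the words in the variables. *)
Record clt_functionals (K : numFieldType) (alpha : K) (p q : seq nat -> K) :
    Prop :=
  CltFunctionals {
    clt_spread : spreadable p /\ spreadable q;
    clt_single : forall x w, count_mem x w = 1%N -> p w = 0 /\ q w = 0;
    clt_pair : forall w, pair_word w -> (p w = 0 /\ q w = 0) \/
      [/\ reduces_to_nil [::] w, p w = 1 & q w = (size w)%:R / 2 * alpha] }.

Lemma pair_word_remove (u v : seq nat) x :
  pair_word (u ++ x :: x :: v) -> x \notin u ++ v /\ pair_word (u ++ v).
Proof.
move=> pw; have xuv : x \notin u ++ v.
  have := pw x; rewrite mem_cat inE eqxx orbT => /(_ isT).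
  rewrite count_cat /= eqxx -has_pred1 has_count count_cat => cx.
  by move: cx; move: (count_mem x u) (count_mem x v) => [|a] [|b] //; rewrite ?addnS.
split=> // y yuv; have yx : x == y = false by apply: contraNF xuv => /eqP->.
have := pw y; rewrite !count_cat /= yx !add0n => <- //.
by move: yuv; rewrite !mem_cat !inE => /orP[] ->; rewrite ?orbT.
Qed.

Section PairRemoval.
Variables (K : numFieldType) (alpha : K) (p q : seq nat -> K).
Hypotheses (p0 : p [::] = 1) (q0 : q [::] = 0).

(** Induction on the length: each deletion shortens the word by two and adds [alpha] to [q], while
    reducibility by the stack machine is unaffected. *)
Lemma pair_values_by_removal :
  (forall w, w != [::] -> pair_word w -> (p w = 0 /\ q w = 0) \/
     exists u x v, [/\ w = u ++ x :: x :: v, p w = p (u ++ v) &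
                       q w = alpha * p (u ++ v) + q (u ++ v)]) ->
  forall w, pair_word w -> (p w = 0 /\ q w = 0) \/
    [/\ reduces_to_nil [::] w, p w = 1 & q w = (size w)%:R / 2 * alpha].
Proof.
move=> removal w; have [n] := ubnP (size w); elim: n w => // n IHn w wn pw.
have [->|w0] := eqVneq w [::].
  by right; split; rewrite ?eqxx// q0 mul0r mul0r.
have [?|[u [x [v [wE pE qE]]]]] := removal w w0 pw; first by left.
move: pw; rewrite wE => /pair_word_remove[_ /IHn].
case=> [|[p_uv0 q_uv0]|[red p_uv q_uv]].
- by move: wn; rewrite wE !size_cat /=; lia.
- by left; rewrite -wE pE qE p_uv0 q_uv0 mulr0 addr0.
right; rewrite -wE pE qE p_uv q_uv wE reduces_to_nil_insert; split=> //.
rewrite !size_cat /= !addnS -natr1 -[in RHS]natr1.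
by field.
Qed.

(* [mu] and [mu'] are the moments of a single variable; one run x^k is deleted
   at a time. *)
Lemma clt_functionals_of_run_removal (mu mu' : nat -> K) :
  mu 1%N = 0 -> mu' 1%N = 0 -> mu 2 = 1 -> mu' 2 = alpha ->
  (forall w, w != [::] -> exists u x k v, w = u ++ nseq k.+1 x ++ v /\
     forall f : nat -> nat, {homo f : y z / (y < z)%N} ->
       p (map f w) = mu k.+1 * p (map f (u ++ v)) /\
       q (map f w) = mu' k.+1 * p (map f (u ++ v)) + mu k.+1 * q (map f (u ++ v))) ->
  clt_functionals alpha p q.
Proof.
move=> mu1 mu'1 mu2 mu'2 removal.
(* [removal] chooses the run before [f] is given, so the same run is deleted from [w] and from
   [map f w], and induction on the length applies. *)
have spread f w : {homo f : y z / (y < z)%N} -> p (map f w) = p w /\ q (map f w) = q w.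
  move=> f_incr; have [n] := ubnP (size w); elim: n w => // n IHn w wn.
  have [->|w0] // := eqVneq w [::].
  have [u [x [k [v [wE rem]]]]] := removal w w0.
  have [] := IHn (u ++ v).
    by move: wn; rewrite wE !size_cat size_nseq; lia.
  have [-> ->] := rem f f_incr; have [] := rem id (fun x y => id).
  by rewrite !map_id => -> -> -> ->.
have removal_id w : w != [::] -> exists u x k v, [/\ w = u ++ nseq k.+1 x ++ v,
    p w = mu k.+1 * p (u ++ v) &
    q w = mu' k.+1 * p (u ++ v) + mu k.+1 * q (u ++ v)].
  move=> w0; have [u [x [k [v [wE rem]]]]] := removal w w0.
  exists u, x, k, v; have [] := rem id (fun x y => id).
  by rewrite !map_id.
split.
- by split=> f w f_incr; have [] := spread f w f_incr.
- move=> x w; have [n] := ubnP (size w); elim: n w => // n IHn w wn cx.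
  have w0 : w != [::] by case: w cx {wn}.
  have [u [y [k [v [wE -> ->]]]]] := removal_id w w0.
  have [yx|yx] := eqVneq y x.
    have -> : k = 0%N; last by rewrite mu1 mu'1 !mul0r addr0.
    by move: cx; rewrite wE !count_cat count_nseq /= yx eqxx; lia.
  have [] := IHn (u ++ v).
  + by move: wn; rewrite wE !size_cat size_nseq; lia.
  + by rewrite -cx wE !count_cat count_nseq /= (negbTE yx) mul0n.
  by move=> -> ->; rewrite !mulr0 addr0.
- apply: pair_values_by_removal => w w0 pw.
  have [u [x [k [v [wE -> ->]]]]] := removal_id w w0.
  (* A run of length 1 contributes vanishing first moments, a run of length 2 is a deleted pair, and
     a longer run is impossible in a pair word. *)
  case: k wE => [|[|k]] wE.
  + by left; rewrite mu1 mu'1 !mul0r addr0.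
  + by right; exists u, x, v; split; rewrite // ?mu2 ?mu'2 !mul1r.
  have := pw x; rewrite wE !mem_cat mem_nseq eqxx /= orbT => /(_ isT).
  by rewrite !count_cat /= !eqxx !add1n !addnS.
Qed.

End PairRemoval.

(** * Sums over onto words: vanishing, the factor [k * alpha], and growth *)

Section Moments.
Variables (K : numFieldType) (alpha : K) (p q : seq nat -> K).
Hypothesis clt : clt_functionals alpha p q.

Lemma onto_sum_singleton n k : (n < k.*2)%N ->
  onto_sum p n k = 0 /\ onto_sum q n k = 0.
Proof.
move=> nk; suff both (t : n.-tuple 'I_k) : [forall x, x \in t] ->
    p (word t) = 0 /\ q (word t) = 0.
  by split; apply: big1 => t /both[].
move=> /(onto_tuple_dichotomy (ltnW nk))[[x /(clt_single clt)] //|[nE]].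
by rewrite nE ltnn in nk.
Qed.

Lemma onto_sum_pairs k :
  onto_sum q k.*2 k = k%:R * alpha * onto_sum p k.*2 k.
Proof.
rewrite /onto_sum mulr_sumr; apply: eq_bigr => t.
move=> /(onto_tuple_dichotomy (leqnn _))[[x /(clt_single clt)[-> ->]] |[_]].
  by rewrite mulr0.
move=> /(clt_pair clt)[[-> ->]|[_ -> ->]]; first by rewrite mulr0.
by rewrite mulr1 size_map size_tuple -muln2 natrM mulfK ?pnatr_eq0.
Qed.

(** Only reducing words contribute, each with value at most 1 in norm, so the sum is at most
    [2 ^ (2k) * k ^ k]. Since [k ^ k / k! <= 4 ^ k], the quotient is at most [16 ^ k], that is
    [4 ^ n] for [n = 2k]. *)
Lemma norm_onto_sum_pairs k :
  `|onto_sum p k.*2 k / k`!%:R| <= 16%:R ^+ k.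
Proof.
have le_count : `|onto_sum p k.*2 k| <=
    (\sum_(t : k.*2.-tuple 'I_k) reduces_to_nil [::] (word t))%:R.
  apply: le_trans (ler_norm_sum _ _ _) _.
  rewrite natr_sum [leRHS](bigID (fun t : k.*2.-tuple 'I_k => [forall x, x \in t])) /=.
  rewrite -[leLHS]addr0 lerD ?sumr_ge0// ?ler_sum// => t.
  move=> /(onto_tuple_dichotomy (leqnn _))[[x /(clt_single clt)[-> _]] |[_]].
    by rewrite normr0.
  move=> /(clt_pair clt)[[-> _]|[-> -> _]]; first by rewrite normr0.
  by rewrite normr1.
rewrite normrM normfV normr_nat ler_pdivrMr ?ltr0n ?fact_gt0//.
apply: le_trans le_count _; rewrite -natrX -natrM ler_nat.
(* The counting bound needs a nonempty alphabet, so [k = 0] is separate. *)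
case: k => [|k].
  by rewrite (big_tuple0 (V := nat) (fun t => reduces_to_nil [::] (word t) : nat)).
apply: leq_trans (count_reducing_words (j := k.+1) _ _) _; rewrite ?add0n//.
rewrite -[16%N]/(2 ^ 2 * 4)%N expnMn -expnM mul2n -mulnA leq_mul2l.
by rewrite -mul2n [(2 ^ (2 * _))%N]expnM expnn_le_fact orbT.
Qed.

End Moments.

Local Open Scope classical_set_scope.

(** * Boolean and monotone independence *)

Section SeqProducts.
Variable A : pzRingType.
Implicit Types s : seq (nat * A).

Let d : nat * A := (0%N, 0).

(** Lists of pairs (index, element) replace families over ['I_n], so that factors can be deleted
    without reindexing. *)
Definition seq_prod s : A := \prod_(c <- s) c.2.

Lemma seq_prod_ord s :
  \prod_(j < size s) (nth d s j).2 = seq_prod s.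
Proof. by rewrite /seq_prod (big_nth d) big_mkord. Qed.

Lemma seq_prod_ord_remove s j : (j < size s)%N ->
  \prod_(k < size s | k != j :> nat) (nth d s k).2 =
  seq_prod (take j s ++ drop j.+1 s).
Proof.
move=> js; rewrite -(big_mkord (fun k => k != j) (fun k => (nth d s k).2)).
rewrite -big_filter -(big_map (nth d s) xpredT (fun c => c.2)) /seq_prod.
congr bigop; rewrite /index_iota subn0.
have -> : size s = (j + (1 + (size s - j.+1)))%N by lia.
rewrite iotaD iotaD !filter_cat /= eqxx /= add0n addn1.
rewrite (@eq_in_filter _ _ xpredT); last by move=> k; rewrite mem_iota; lia.
rewrite (@eq_in_filter _ (fun k => k != j) xpredT (iota j.+1 _)); last first.
  by move=> k; rewrite mem_iota; lia.
rewrite !filter_predT map_cat !map_nth_iota ?drop0//; try lia.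
by rewrite [X in _ ++ X]take_oversize// size_drop.
Qed.

Definition alternating_seq s := sorted (fun p q => p.1 != q.1) s.

Lemma alternating_seqP s : alternating_seq s ->
  alternating (fun j : 'I_(size s) => (nth d s j).1).
Proof.
move=> /(sortedP d) alt j k kE; rewrite kE; apply/eqP/alt.
by rewrite -kE.
Qed.

End SeqProducts.

(** The pair [(x, k)] encodes a run of length [k.+1], so runs are never empty and their powers lie
    in the non-unital algebra. *)
Definition runs_word (r : seq (nat * nat)) : seq nat :=
  flatten [seq nseq p.2.+1 p.1 | p <- r].

Lemma runs_wordP w :
  exists2 r : seq (nat * nat), sorted (fun p q => p.1 != q.1) r & w = runs_word r.
Proof.
elim: w => [|x w [r r_alt ->]]; first by exists [::].
case: r r_alt => [|[y k] r] r_alt; first by exists [:: (x, 0%N)].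
have [->|xy] := eqVneq x y; first by exists ((y, k.+1) :: r) => //; case: r r_alt.
by exists ((x, 0%N) :: (y, k) :: r) => //=; rewrite xy.
Qed.

(** The run is the leftmost one of the largest letter, hence a peak for the monotone rule. *)
Lemma max_runP (w : seq nat) : w != [::] -> exists u x k v,
  [/\ w = u ++ nseq k.+1 x ++ v, all (fun y => y < x)%N u
    & forall y v', v = y :: v' -> (y < x)%N].
Proof.
(* The extra bound on [v] keeps [x] maximal in the whole word; it is used when a larger letter is
   prepended. *)
suff: w != [::] -> exists u x k v,
  [/\ w = u ++ nseq k.+1 x ++ v, all (fun y => y < x)%N u,
    all (fun y => y <= x)%N v & forall y v', v = y :: v' -> (y < x)%N].
  by move=> h /h[u [x [k [v [? ? _ ?]]]]]; exists u, x, k, v.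
elim: w => // z w IHw _; case: (eqVneq w [::]) => [->|/IHw].
  by exists [::], z, 0%N, [::].
move=> [u [x [k [v [-> ux vx hv]]]]].
case: (ltngtP z x) => [zx|xz|zx].
- by exists (z :: u), x, k, v; split=> //=; rewrite zx.
- exists [::], z, 0%N, (u ++ nseq k.+1 x ++ v); split=> //.
    rewrite !all_cat all_nseq (ltnW xz) orbT /=; apply/andP; split.
      by apply: sub_all ux => y yx; lia.
    by apply: sub_all vx => y yx; lia.
  by case: u ux => [|t u] /= ux y v' [<- _] //; move: ux; lia.
- rewrite zx; case: u ux => [|t u] ux.
    by exists [::], x, k.+1, v.
  exists [::], x, 0%N, ((t :: u) ++ nseq k.+1 x ++ v); split=> //.
    rewrite all_cat all_cat all_nseq leqnn orbT vx !andbT.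
    by apply: sub_all ux => y yx; exact: ltnW.
  by move=> y v' [<- _]; move: ux => /= /andP[].
Qed.

Section Independence.
Variables (R : realType) (A : algType R[i]) (phi phi' : {scalar A}).
Variables (a : A) (a_ : nat -> A).
Hypotheses (phi1 : phi 1 = 1) (phi'1 : phi' 1 = 0).
Hypothesis a_id : identically_distributed phi phi' a a_.

Definition word_moment (psi : A -> R[i]) (w : seq nat) : R[i] :=
  psi (\prod_(i <- w) a_ i).

Lemma nonunital_exp (x : A) k : nonunital_alg x (x ^+ k.+1).
Proof.
exists 'X^(k.+1); first by rewrite coefXn.
by rewrite rmorphXn /= horner_algX.
Qed.

Lemma prod_nseq x k : \prod_(i <- nseq k x) a_ i = a_ x ^+ k.
Proof. by rewrite big_nseq -Monoid.iteropE. Qed.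

Section Boolean.
Hypothesis a_bool : inf_boolean phi phi' (fun i => nonunital_alg (a_ i)).

(** The Boolean product formula and its Leibniz rule, split at the first factor. Independence says
    nothing about the empty product, so for empty [s] the values of [phi] and [phi'] at 1 are
    used. *)
Lemma boolean_seq_cons c (s : seq (nat * A)) : alternating_seq (c :: s) ->
  (forall p, p \in c :: s -> nonunital_alg (a_ p.1) p.2) ->
  phi (seq_prod (c :: s)) = phi c.2 * phi (seq_prod s) /\
  phi' (seq_prod (c :: s)) =
    phi' c.2 * phi (seq_prod s) + phi c.2 * phi' (seq_prod s).
Proof.
move=> alt mem; case: (eqVneq s [::]) => [->|s0].
  by rewrite /seq_prod big_seq1 big_nil phi1 phi'1 !mulr1 mulr0 addr0.
have rule t : t != [::] -> alternating_seq t ->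
    (forall p, p \in t -> nonunital_alg (a_ p.1) p.2) ->
    phi (seq_prod t) = \prod_(j < size t) phi (nth (0%N, 0) t j).2 /\
    phi' (seq_prod t) = \sum_(j < size t) phi' (nth (0%N, 0) t j).2 *
       \prod_(k < size t | k != j) phi (nth (0%N, 0) t k).2.
  move=> t0 /alternating_seqP t_alt t_mem; rewrite -seq_prod_ord.
  apply: (a_bool _ t_alt); first by rewrite lt0n size_eq0.
  by move=> j; apply: t_mem; apply: mem_nth.
have [-> ->] := rule (c :: s) isT alt mem.
have [-> ->] := rule s s0 (path_sorted alt)
  (fun p ps => mem p (mem_behead (s := c :: s) ps)).
rewrite /= !big_ord_recl /=; split=> //; congr (_ + _).
  by rewrite big_mkcond big_ord_recl /= mul1r.
rewrite mulr_sumr; apply: eq_bigr => j _.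
rewrite big_mkcond big_ord_recl /= mulrCA; congr (_ * (_ * _)).
rewrite [RHS]big_mkcond; apply: eq_bigr => k _.
by rewrite (inj_eq (@lift_inj _ ord0)).
Qed.

Lemma boolean_clt alpha : phi a = 0 -> phi' a = 0 ->
  phi (a ^+ 2) = 1 -> phi' (a ^+ 2) = alpha ->
  clt_functionals alpha (word_moment phi) (word_moment phi').
Proof.
move=> phi_a phi'_a phi_a2 phi'_a2.
apply: (@clt_functionals_of_run_removal _ _ _ _ _ _
  (fun k => phi (a ^+ k)) (fun k => phi' (a ^+ k))); rewrite /word_moment ?big_nil //.
move=> w w0; have [r r_alt wE] := runs_wordP w.
case: r r_alt wE => [|[x k] r] r_alt wE; first by rewrite wE in w0.
exists [::], x, k, (runs_word r); split=> // f f_incr.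
have f_inj := homo_ltn_inj f_incr.
pose s r' : seq (nat * A) := [seq (f p.1, a_ (f p.1) ^+ p.2.+1) | p <- r'].
have sE r' : \prod_(i <- map f (runs_word r')) a_ i = seq_prod (s r').
  rewrite /runs_word map_flatten big_flatten /seq_prod !big_map.
  by apply: eq_bigr => p _; rewrite big_map big_nseq -Monoid.iteropE.
have [] := @boolean_seq_cons (f x, a_ (f x) ^+ k.+1) (s r).
- rewrite /alternating_seq -[_ :: s r]/(s ((x, k) :: r)) /s sorted_map.
  by apply: sub_sorted r_alt => p q /=; rewrite (inj_eq f_inj).
- move=> p; rewrite -[_ :: s r]/(s ((x, k) :: r)) => /mapP[q _ ->] /=.
  exact: nonunital_exp.
rewrite -[_ :: s r]/(s ((x, k) :: r)) -!sE wE /=.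
by have [-> ->] := a_id (f x) k.+1.
Qed.

End Boolean.

Section Monotone.
Hypothesis a_mono : inf_monotone phi phi' (fun i => nonunital_alg (a_ i)).

Lemma monotone_seq_peak (s1 s2 : seq (nat * A)) c :
  (forall p, p \in s1 ++ c :: s2 -> nonunital_alg (a_ p.1) p.2) ->
  (forall p, p \in s1 -> (p.1 < c.1)%N) ->
  (forall p s, s2 = p :: s -> (p.1 < c.1)%N) ->
  phi (seq_prod (s1 ++ c :: s2)) = phi c.2 * phi (seq_prod (s1 ++ s2)) /\
  phi' (seq_prod (s1 ++ c :: s2)) =
    phi' c.2 * phi (seq_prod (s1 ++ s2)) + phi c.2 * phi' (seq_prod (s1 ++ s2)).
Proof.
move=> mem lt1 lt2; set t := s1 ++ c :: s2.
have jt : (size s1 < size t)%N by rewrite size_cat /= addnS ltnS leq_addr.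
pose j := Ordinal jt.
have tj : nth (0%N, 0) t j = c by rewrite nth_cat ltnn subnn.
have pk : peak (fun j : 'I_(size t) => (nth (0%N, 0) t j).1) j.
  move=> k /orP[/eqP kj|/eqP kj]; rewrite tj.
    rewrite nth_cat; have ks1 : (k < size s1)%N by move: kj => /=; lia.
    by rewrite ks1; apply/lt1/mem_nth.
  have := ltn_ord k; rewrite -kj /= /t -cat_rcons nth_cat size_rcons ltnn subnn.
  rewrite size_cat size_rcons; case: (s2) lt2 => [|p s] lt2 /=; first by lia.
  by move=> _; apply: (lt2 p s).
have mem_nth_t k : (k < size t)%N ->
    nonunital_alg (a_ (nth (0%N, 0) t k).1) (nth (0%N, 0) t k).2.
  by move=> kt; apply: mem; apply: mem_nth.
have := a_mono (fun k : 'I_(size t) => mem_nth_t k (ltn_ord k)) pk.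
rewrite seq_prod_ord tj (seq_prod_ord_remove jt).
rewrite take_size_cat// (_ : drop _ t = s2)//.
by rewrite /t -cat_rcons drop_size_cat// size_rcons.
Qed.

(** The maximal run is grouped into one power, so that its neighbours have strictly smaller index.
    The other letters stay single factors: the monotone rule does not ask for an alternating
    word. *)
Lemma monotone_clt alpha : phi a = 0 -> phi' a = 0 ->
  phi (a ^+ 2) = 1 -> phi' (a ^+ 2) = alpha ->
  clt_functionals alpha (word_moment phi) (word_moment phi').
Proof.
move=> phi_a phi'_a phi_a2 phi'_a2.
apply: (@clt_functionals_of_run_removal _ _ _ _ _ _
  (fun k => phi (a ^+ k)) (fun k => phi' (a ^+ k))); rewrite /word_moment ?big_nil //.
move=> w /max_runP[u [x [k [v [wE ux vx]]]]].
exists u, x, k, v; split=> // f f_incr.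
pose s u' : seq (nat * A) := [seq (f y, a_ (f y)) | y <- u'].
have sE u' : \prod_(i <- map f u') a_ i = seq_prod (s u').
  by rewrite /seq_prod !big_map.
have s_mem u' p : p \in s u' -> nonunital_alg (a_ p.1) p.2.
  by move=> /mapP[y _ ->] /=; exact: (nonunital_exp _ 0).
have [] := @monotone_seq_peak (s u) (s v) (f x, a_ (f x) ^+ k.+1).
- move=> p; rewrite mem_cat inE => /or3P[/s_mem //|/eqP ->|/s_mem //].
  exact: nonunital_exp.
- by move=> p /mapP[y yu ->] /=; apply: f_incr; exact: (allP ux).
- case: (v) vx => [|y v'] vx p s' //= [<- _] /=; apply: f_incr; exact: (vx y v').
rewrite -map_cat -sE.
have -> : seq_prod (s u ++ (f x, a_ (f x) ^+ k.+1) :: s v) =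
    \prod_(i <- map f w) a_ i.
  rewrite wE !map_cat !big_cat map_nseq prod_nseq /seq_prod big_cat big_cons /=.
  by rewrite !big_map.
by have [-> ->] := a_id (f x) k.+1.
Qed.

End Monotone.
End Independence.

(** * Freeness *)

Lemma sorted_or_split (T : Type) (e : rel T) (s : seq T) :
  sorted e s \/ exists s1 x y s2, s = s1 ++ x :: y :: s2 /\ ~~ e x y.
Proof.
elim: s => [|x s [s_sorted|[s1 [y [z [s2 [-> yz]]]]]]]; first by left.
  case: s s_sorted => [|y s] /= s_sorted; first by left.
  case: (boolP (e x y)) => xy; first by left; rewrite s_sorted.
  by right; exists [::], x, y, s.
by right; exists (x :: s1), y, z, s2.
Qed.

Section Free.
Variables (R : realType) (A : algType R[i]) (phi phi' : {scalar A}).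
Variables (a : A) (a_ : nat -> A).
Hypotheses (phi1 : phi 1 = 1) (phi'1 : phi' 1 = 0).
Hypothesis a_id : identically_distributed phi phi' a a_.
Hypothesis a_free : inf_free phi phi' (fun i => unital_alg (a_ i)).

(** A factor stores a polynomial instead of an element of [A], so that one list can be evaluated
    under any relabelling and centring does not depend on the index. *)
Let factor := (nat * {poly R[i]})%type.
Implicit Types (s : seq factor) (psi : {scalar A}).

Definition factor_prod (f : nat -> nat) s : A :=
  \prod_(c <- s) horner_alg (a_ (f c.1)) c.2.

Definition poly_mean (p : {poly R[i]}) : R[i] := phi (horner_alg a p).
Definition poly_mean' (p : {poly R[i]}) : R[i] := phi' (horner_alg a p).
Definition center (p : {poly R[i]}) : {poly R[i]} := p - (poly_mean p)%:P.

Definition alternating_factors s := sorted (fun c d => c.1 != d.1) s.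

Lemma horner_alg_sum (x : A) p :
  horner_alg x p = \sum_(k < size p) p`_k *: x ^+ k.
Proof.
rewrite -[p in LHS]coefK poly_def linear_sum /=; apply: eq_bigr => k _.
by rewrite linearZ /= rmorphXn /= horner_algX -scalerAl mul1r.
Qed.

Lemma mean_horner_alg i p : phi (horner_alg (a_ i) p) = poly_mean p /\
  phi' (horner_alg (a_ i) p) = poly_mean' p.
Proof.
rewrite /poly_mean /poly_mean' !horner_alg_sum !linear_sum.
by split; apply: eq_bigr => k _; have [e e'] := a_id i k; rewrite !linearZ /= ?e ?e'.
Qed.

Lemma poly_mean_center p : poly_mean (center p) = 0.
Proof.
rewrite {1}/poly_mean linearB /= horner_algC linearB linearZ /= phi1.
by rewrite mulr1 subrr.
Qed.

Lemma poly_mean'_center p : poly_mean' (center p) = poly_mean' p.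
Proof.
rewrite {1}/poly_mean' linearB /= horner_algC linearB linearZ /= phi'1.
by rewrite mulr0 subr0.
Qed.

Lemma factor_prod_merge f s1 i p q s2 :
  factor_prod f (s1 ++ (i, p) :: (i, q) :: s2) =
  factor_prod f (s1 ++ (i, p * q) :: s2).
Proof. by rewrite /factor_prod !big_cat !big_cons /= rmorphM /= !mulrA. Qed.

Lemma factor_prod_center psi f s1 i p s2 :
  psi (factor_prod f (s1 ++ (i, p) :: s2)) =
  psi (factor_prod f (s1 ++ (i, center p) :: s2)) +
  poly_mean p * psi (factor_prod f (s1 ++ s2)).
Proof.
rewrite /factor_prod !big_cat !big_cons /= linearB /= horner_algC.
rewrite mulrBl mulrBr linearB /= -scalerAl mul1r -scalerAr linearZ /=.
by rewrite subrK.
Qed.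

(** This is the recursion by which freeness determines all moments: merge neighbours from the same
    algebra, otherwise centre the factors one by one. Merging shortens the word, and so does the
    constant split off by centring. *)
Lemma factor_seq_ind (P : seq factor -> Prop) :
  (forall s1 i p q s2, P (s1 ++ (i, p * q) :: s2) ->
     P (s1 ++ (i, p) :: (i, q) :: s2)) ->
  (forall s1 i p s2, P (s1 ++ (i, center p) :: s2) -> P (s1 ++ s2) ->
     P (s1 ++ (i, p) :: s2)) ->
  (forall s, alternating_factors s -> (forall c, c \in s -> poly_mean c.2 = 0) ->
     (forall s', (size s' < size s)%N -> P s') -> P s) ->
  forall s, P s.
Proof.
move=> P_merge P_center P_base s; have [n] := ubnP (size s).
elim: n s => // n IHn s sn.
have [alt|[s1 [[i p] [[j q] [s2 [sE]]]]]] :=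
  sorted_or_split (fun c d : factor => c.1 != d.1) s.
  (* [s1] is the prefix already centred and [s2] the rest. Centring keeps the length, so this inner
     induction runs on [s2]. *)
  suff: forall s2 s1, (forall c, c \in s1 -> poly_mean c.2 = 0) ->
      alternating_factors (s1 ++ s2) -> (size (s1 ++ s2) < n.+1)%N -> P (s1 ++ s2).
    by move=> /(_ s [::]); apply.
  elim=> [|[i p] s2 IHs2] s1 s1_centered s12_alt s12_size.
    rewrite cats0 in s12_alt s12_size *; apply: P_base => // s' s's.
    by apply: IHn; rewrite -ltnS (leq_trans _ s12_size).
  apply: P_center; last first.
    by apply: IHn; move: s12_size; rewrite !size_cat /=; lia.
  rewrite -cat_rcons; apply: IHs2.
  - move=> c; rewrite mem_rcons inE => /orP[/eqP -> /=|/s1_centered //].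
    exact: poly_mean_center.
  - have altE t : alternating_factors t = sorted (fun i j => i != j) (map fst t).
      by rewrite sorted_map.
    by move: s12_alt; rewrite !altE cat_rcons !map_cat.
  - by move: s12_size; rewrite cat_rcons !size_cat.
rewrite negbK => /eqP /= ij; rewrite sE -ij; apply: P_merge; apply: IHn.
by move: sn; rewrite sE !size_cat /=; lia.
Qed.

Lemma free_centered_prod f s : injective f -> s != [::] ->
  alternating_factors s -> (forall c, c \in s -> poly_mean c.2 = 0) ->
  phi (factor_prod f s) = 0 /\
  phi' (factor_prod f s) = \sum_(0 <= j < size s)
    poly_mean' (nth (0%N, 0) s j).2 * phi (factor_prod f (take j s ++ drop j.+1 s)).
Proof.
move=> f_inj s0 alt centered.
pose g (c : factor) : nat * A := (f c.1, horner_alg (a_ (f c.1)) c.2).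
have gE s' : factor_prod f s' = seq_prod (map g s') by rewrite /seq_prod big_map.
have g_alt : alternating_seq (map g s).
  rewrite /alternating_seq sorted_map; apply: sub_sorted alt => c d /=.
  by rewrite (inj_eq f_inj).
have nthE j : (j < size s)%N -> nth (0%N, 0) (map g s) j = g (nth (0%N, 0) s j).
  by move=> js; rewrite (nth_map (0%N, 0)).
have [||j|] := a_free _ (alternating_seqP g_alt)
  (c := fun j => (nth (0%N, 0) (map g s) j).2).
- by rewrite size_map lt0n size_eq0.
- move=> j; have js : (j < size s)%N by rewrite -(size_map g).
  by rewrite nthE //=; exists (nth (0%N, 0) s j).2.
- have js : (j < size s)%N by rewrite -(size_map g).
  by rewrite nthE //=; have [-> _] := mean_horner_alg (f (nth (0%N, 0) s j).1)
    (nth (0%N, 0) s j).2; apply: centered; apply: mem_nth.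
rewrite seq_prod_ord -gE => -> ->; split=> //.
rewrite -[X in \sum_(0 <= j < X) _](size_map g) big_mkord; apply: eq_bigr => j _.
have js : (j < size s)%N by rewrite -(size_map g).
rewrite (seq_prod_ord_remove (ltn_ord j)) -map_take -map_drop -map_cat -gE nthE //=.
by have [_ ->] := mean_horner_alg (f (nth (0%N, 0) s j).1) (nth (0%N, 0) s j).2.
Qed.

Lemma size_take_drop_lt s j : (j < size s)%N ->
  (size (take j s ++ drop j.+1 s) < size s)%N.
Proof. by move=> js; rewrite size_cat size_drop size_takel; lia. Qed.

(** Merging, centring and the rule for centred alternating words do not involve [f], as long as [f]
    keeps distinct indices distinct. *)
Lemma free_spread f : injective f -> forall s,
  phi (factor_prod f s) = phi (factor_prod id s) /\
  phi' (factor_prod f s) = phi' (factor_prod id s).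
Proof.
move=> f_inj; apply: factor_seq_ind => [s1 i p q s2|s1 i p s2|s alt centered IH].
- by rewrite !factor_prod_merge.
- rewrite ![_ (factor_prod _ (s1 ++ (i, p) :: s2))]factor_prod_center.
  by move=> [-> ->] [-> ->].
have [->|s0] := eqVneq s [::]; first by rewrite /factor_prod !big_nil.
have [-> ->] := free_centered_prod f_inj s0 alt centered.
have [-> ->] := free_centered_prod (fun x y => id) s0 alt centered.
split=> //; rewrite !big_mkord; apply: eq_bigr => j _.
by have [-> _] := IH _ (size_take_drop_lt (ltn_ord j)).
Qed.

Let others x s := [seq c <- s | c.1 != x].

(* A centred factor of an algebra that occurs only once in a product behaves
   as if it were free from the product of the remaining factors. *)
Lemma free_single_centered x s :
  count (fun c => c.1 == x) s = 1%N ->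
  (forall c, c \in s -> c.1 == x -> poly_mean c.2 = 0) ->
  phi (factor_prod id s) = 0 /\
  phi' (factor_prod id s) =
    (\sum_(c <- s | c.1 == x) poly_mean' c.2) * phi (factor_prod id (others x s)).
Proof.
elim/factor_seq_ind: s => [s1 i p q s2 IH|s1 i p s2 IH1 IH2|s alt centered IH]
  cx cent.
(* Two neighbours of index [x] would contradict the single occurrence. *)
- have ix : (i == x) = false.
    by apply/negP => ix; move: cx; rewrite count_cat /= ix !add1n !addnS.
  rewrite factor_prod_merge; have [] := IH.
  + by move: cx; rewrite !count_cat /= ix.
  + move=> c; rewrite mem_cat inE => /or3P[cs|/eqP -> /=|cs] cx1.
    * by apply: cent cx1; rewrite mem_cat cs.
    * by rewrite ix in cx1.
    * by apply: cent cx1; rewrite mem_cat !inE cs !orbT.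
  move=> -> ->; rewrite !big_cat !big_cons /= ix /others !filter_cat /= ix /=.
  by rewrite factor_prod_merge.
(* The factor of index [x] is centred already, so centring it changes nothing. *)
- have [ix|ix] := eqVneq i x.
    have pE : center p = p.
      by rewrite /center (cent (i, p)) ?subr0 //= ?ix ?eqxx// mem_cat inE eqxx orbT.
    by rewrite pE in IH1; exact: IH1.
  have [] := IH1.
  + by move: cx; rewrite !count_cat /= (negbTE ix).
  + move=> c; rewrite mem_cat inE => /or3P[cs|/eqP -> /=|cs] cx1.
    * by apply: cent cx1; rewrite mem_cat cs.
    * by rewrite (negbTE ix) in cx1.
    * by apply: cent cx1; rewrite mem_cat !inE cs !orbT.
  have [] := IH2.
  + by move: cx; rewrite !count_cat /= (negbTE ix).
  + move=> c; rewrite mem_cat => /orP[cs|cs] cx1.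
    * by apply: cent cx1; rewrite mem_cat cs.
    * by apply: cent cx1; rewrite mem_cat !inE cs !orbT.
  move=> e2 e2' e1 e1'; rewrite (factor_prod_center phi) (factor_prod_center phi').
  rewrite e1 e1' e2 e2' mulr0 addr0; split=> //.
  rewrite !big_cat !big_cons /= (negbTE ix) /others !filter_cat /= ix /=.
  by rewrite [in RHS](factor_prod_center phi) mulrDr mulrCA.
have s0 : s != [::] by case: s cx {alt centered IH cent}.
have [-> ->] := free_centered_prod (fun x y => id) s0 alt centered.
split=> //; rewrite mulr_suml [RHS](big_nth (0%N, 0)) [RHS]big_mkcond /=.
rewrite !big_mkord; apply: eq_bigr => j _.
have sE := cat_take_drop j s; rewrite (drop_nth (0%N, 0) (ltn_ord j)) in sE.
(* In the Leibniz sum, deleting a factor of index other than [x] leaves [x] once, so [phi] of the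
   rest vanishes by induction. Only the term that deletes the [x] factor survives. *)
case: ifPn => jx; last first.
  have [||-> _] := IH _ (size_take_drop_lt (ltn_ord j)); rewrite ?mulr0//.
    by rewrite -cx -[in RHS]sE !count_cat /= (negbTE jx).
  move=> c; rewrite mem_cat => cs; apply: cent; rewrite -sE mem_cat inE.
  by case/orP: cs => ->; rewrite ?orbT.
congr (_ * phi (factor_prod id _)).
rewrite /others -[in RHS]sE filter_cat /= jx /= -filter_cat; apply/esym/all_filterP.
rewrite all_count; apply/eqP; rewrite -[RHS](count_predC (fun c => c.1 == x)).
suff -> : count (fun c => c.1 == x) (take j s ++ drop j.+1 s) = 0%N by exact: eq_count.
by move: cx; rewrite -[in LHS]sE !count_cat /= jx add1n addnS => -[].
Qed.

(** In general a run does not factor out of a free product, but it does when its letter occurs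
    nowhere else. An adjacent equal pair in a pair word is such a run. *)
Lemma free_clt alpha : phi a = 0 -> phi' a = 0 ->
  phi (a ^+ 2) = 1 -> phi' (a ^+ 2) = alpha ->
  clt_functionals alpha (word_moment a_ phi) (word_moment a_ phi').
Proof.
move=> phi_a phi'_a phi_a2 phi'_a2.
pose letters w : seq factor := [seq (y, 'X) | y <- w].
have wE psi w : word_moment a_ psi w = psi (factor_prod id (letters w)).
  rewrite /word_moment /factor_prod big_map.
  by under [in RHS]eq_bigr do rewrite horner_algX.
have meanX : poly_mean 'X = 0 by rewrite /poly_mean horner_algX.
have mean'X : poly_mean' 'X = 0 by rewrite /poly_mean' horner_algX.
have letters_centered w c : c \in letters w -> poly_mean c.2 = 0.
  by move=> /mapP[y _ ->].
split.
- have wfE psi f w : word_moment a_ psi (map f w) = psi (factor_prod f (letters w)).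
    by rewrite wE /factor_prod !big_map.
  by split=> f w /homo_ltn_inj f_inj; rewrite wfE wE;
    have [] := free_spread f_inj (letters w).
- move=> x w cx; rewrite !wE.
  have [||-> ->] := @free_single_centered x (letters w).
  + by rewrite count_map.
  + by move=> c /letters_centered.
  split=> //; rewrite big_map big1 ?mul0r//.
apply: pair_values_by_removal.
- by rewrite /word_moment big_nil.
- by rewrite /word_moment big_nil.
move=> w w0 pw.
have [alt|[u [x [y [v [wuv]]]]]] := sorted_or_split (fun x y => x != y) w.
  left; rewrite !wE.
  have [|||-> ->] := @free_centered_prod id (letters w) (fun x y => id).
  + by rewrite -size_eq0 size_map size_eq0.
  + by rewrite /alternating_factors sorted_map.
  + exact: letters_centered.
  split=> //; rewrite big_nat big1 // => j; rewrite size_map => /andP[_ jw].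
  by rewrite (nth_map 0%N) // mean'X mul0r.
rewrite negbK => /eqP xy; rewrite -{y}xy in wuv; right; exists u, x, v.
have [xuv _] : x \notin u ++ v /\ pair_word (u ++ v).
  by apply: pair_word_remove; rewrite -wuv.
have meanXX : poly_mean ('X * 'X) = 1 by rewrite /poly_mean rmorphM /= horner_algX.
have mean'XX : poly_mean' ('X * 'X) = alpha by rewrite /poly_mean' rmorphM /= horner_algX.
have notin y : y \in u ++ v -> (y == x) = false.
  by move=> yuv; apply: contraNF xuv => /eqP <-.
(* The pair [x x] is split as its centred part plus 1. The centred part is the only factor of index
   [x]; it gives 0 under [phi] and [alpha * phi] of the rest under [phi']. *)
have [||F F'] := @free_single_centered x (letters u ++ (x, center ('X * 'X)) :: letters v).
- rewrite count_cat /= eqxx addnCA -count_cat -map_cat count_map.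
  rewrite (eq_in_count (a2 := pred0)); last by move=> y /notin.
  by rewrite count_pred0.
- move=> c; rewrite mem_cat inE => /or3P[/letters_centered //|/eqP ->|/letters_centered //] _.
  exact: poly_mean_center.
have wE' psi : word_moment a_ psi w =
    psi (factor_prod id (letters u ++ (x, center ('X * 'X)) :: letters v)) +
    word_moment a_ psi (u ++ v).
  rewrite !wE wuv /letters map_cat /= factor_prod_merge.
  rewrite [LHS]factor_prod_center meanXX.
  by rewrite mul1r map_cat.
rewrite !wE' F F' add0r; split=> //; congr (_ + _).
have others_all t : {subset t <= u ++ v} -> others x (letters t) = letters t.
  move=> tuv; apply/all_filterP; rewrite all_map; apply/allP => y /tuv /notin /=.
  by move=> ->.
have no_x t : {subset t <= u ++ v} ->
    \sum_(c <- letters t | c.1 == x) poly_mean' c.2 = 0.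
  by move=> tuv; rewrite big_map big1.
have uS : {subset u <= u ++ v} by move=> y yu; rewrite mem_cat yu.
have vS : {subset v <= u ++ v} by move=> y yv; rewrite mem_cat yv orbT.
rewrite big_cat big_cons /= eqxx !no_x // poly_mean'_center mean'XX add0r addr0.
rewrite wE /others filter_cat /= eqxx /= -/(others x _) -/(others x _) !others_all //.
by rewrite /letters map_cat.
Qed.

End Free.

(** * Limit moments *)

Section LimitMoments.
Variable K : numClosedFieldType.
(** The Archimedean property of [K], established for [R[i]] in [cvg_invn_complex]. *)
Hypothesis cvg_invn : (fun N : nat => (N%:R^-1 : K^o)) @ \oo --> (0 : K^o).

Lemma cvg_inv_sqrtn : (fun N : nat => ((sqrtC (N%:R : K))^-1 : K^o)) @ \oo --> (0 : K^o).
Proof.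
apply/cvgr0Pnorm_lt => e e0.
have e20 : 0 < e ^+ 2 by rewrite exprn_gt0.
have /cvgr0Pnorm_lt/(_ _ e20) := cvg_invn.
apply: filterS => N.
rewrite !ger0_norm ?invr_ge0 ?sqrtC_ge0 ?ler0n//.
rewrite -[X in X^-1 < _]sqrtCK -exprVn ltr_pXn2r// nnegrE ?(ltW e0)//.
by rewrite invr_ge0 sqrtC_ge0 ler0n.
Qed.

Lemma cvg_ffact_ratio k :
  (fun N : nat => ((N ^_ k)%:R / N%:R ^+ k : K^o)) @ \oo --> (1 : K^o).
Proof.
elim: k => [|k IHk].
  rewrite (_ : (fun N => _) = (fun=> 1 : K^o)); first exact: cvg_cst.
  by apply/funext => N; rewrite ffactn0 expr0 divr1.
have : (fun N : nat => ((N ^_ k)%:R / N%:R ^+ k * (1 - k%:R * N%:R^-1) : K^o)) @ \oo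
    --> (1 * (1 - k%:R * 0) : K^o).
  apply: cvgM IHk _; apply: cvgB; first exact: cvg_cst.
  by apply: cvgM; [exact: cvg_cst | exact: cvg_invn].
rewrite mulr0 subr0 mulr1; apply: cvg_trans; apply: near_eq_cvg.
near=> N; have N0 : (N%:R : K) != 0.
  by rewrite pnatr_eq0 -lt0n; near: N; exact: nbhs_infty_gt.
have kN : (k <= N)%N by near: N; exact: nbhs_infty_ge.
rewrite ffactnSr natrM natrB// exprSr; field.
by rewrite N0 expf_neq0.
Unshelve. all: by end_near. Qed.

(** Of the [n] factors [1 / sqrt N], [2k] normalise the falling factorial and the others tend to 0.
    The power [0 ^+ (n - k.*2)] covers both cases: it is 1 for [n = 2k] and 0 otherwise. *)
Lemma cvg_bin_ratio n k : (k.*2 <= n)%N ->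
  (fun N : nat => ('C(N, k)%:R * (sqrtC (N%:R : K))^-1 ^+ n : K^o)) @ \oo
  --> ((k`!)%:R^-1 * 0 ^+ (n - k.*2) : K^o).
Proof.
move=> kn.
have : (fun N : nat => ((k`!)%:R^-1 * ((N ^_ k)%:R / N%:R ^+ k) *
    (sqrtC (N%:R : K))^-1 ^+ (n - k.*2) : K^o)) @ \oo
    --> ((k`!)%:R^-1 * 1 * 0 ^+ (n - k.*2) : K^o).
  apply: cvgM; first by apply: cvgM; [exact: cvg_cst | exact: cvg_ffact_ratio].
  elim: (n - k.*2)%N => [|m IHm].
    rewrite expr0 (_ : (fun N => _) = (fun=> 1 : K^o)); first exact: cvg_cst.
    by apply/funext => N; rewrite expr0.
  rewrite exprS; under eq_fun do rewrite exprS.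
  by apply: cvgM => //; exact: cvg_inv_sqrtn.
rewrite mulr1; apply: cvg_trans; apply: near_eq_cvg; apply: nearW => N.
rewrite -bin_ffact natrM mulrCA -!mulrA mulVKf ?pnatr_eq0 -?lt0n ?fact_gt0//.
congr (_ * _).
rewrite -[X in (X%:R ^+ k)^-1]/N -[X in (X ^+ k)^-1]sqrtCK -exprM mul2n -exprVn.
by rewrite -exprD subnKC.
Qed.

Definition clt_limit (p : seq nat -> K) (n : nat) : K :=
  if odd n then 0 else onto_sum p n n./2 / (n./2)`!%:R.

(** Words with [k] letters vanish for [2k > n] by hypothesis and are killed by the normalisation for
    [2k < n]; only [2k = n] survives, with weight [1 / k!]. *)
Lemma cvg_clt_words (p : seq nat -> K) n : spreadable p ->
  (forall k, (n < k.*2)%N -> onto_sum p n k = 0) ->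
  (fun N : nat => ((sqrtC (N%:R : K))^-1 ^+ n *
     \sum_(t : n.-tuple 'I_N) p (word t) : K^o)) @ \oo --> (clt_limit p n : K^o).
Proof.
move=> p_spread onto0.
pose L k := if (k.*2 <= n)%N then onto_sum p n k * (k`!%:R^-1 * 0 ^+ (n - k.*2)) else 0.
have -> : clt_limit p n = \sum_(k < n.+1) L k.
  rewrite /clt_limit; have nE := odd_double_half n; case: ifP => n_odd.
    rewrite big1 // => k _; rewrite /L; case: ifP => // kn.
    rewrite expr0n (_ : _ == 0%N = false) ?mulr0//.
    by apply/negP => /eqP; rewrite n_odd in nE; lia.
  rewrite n_odd add0n in nE.
  have n2 : (n./2 < n.+1)%N by lia.
  rewrite (bigD1 (Ordinal n2)) //= big1 => [|k /negP kn].
    by rewrite addr0 /L nE leqnn subnn expr0 mulr1.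
  rewrite /L; case: ifP => // kn2; rewrite expr0n (_ : _ == 0%N = false) ?mulr0//.
  apply/negP => /eqP n0; apply: kn; apply/eqP/val_inj => /=; lia.
rewrite (_ : (fun N => _) = (fun N : nat => \sum_(k < n.+1)
    onto_sum p n k * ('C(N, k)%:R * (sqrtC (N%:R : K))^-1 ^+ n) : K^o)); last first.
  apply/funext => N; rewrite sum_words_by_letters // mulr_sumr.
  apply: eq_bigr => k _.
  by rewrite -[_ *+ 'C(N, k)]mulr_natr mulrCA [_ * 'C(N, k)%:R]mulrC.
apply: cvg_big => [|k _]; first exact: add_continuous.
rewrite /L; case: ifPn => kn.
  by apply: cvgM; [exact: cvg_cst | exact: cvg_bin_ratio].
rewrite onto0 1?ltnNge// (_ : (fun N => _) = (fun=> 0 : K^o)); first exact: cvg_cst.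
by apply/funext => N; rewrite mul0r.
Qed.

End LimitMoments.

(** * Laurent series *)

Section LaurentSeries.
Variable K : numFieldType.
Hypothesis cvg_dominated : forall (u : nat -> K) (c : K),
  (forall n, `|u n| <= c * 2^-1 ^+ n) ->
  cvgn (fun N => \sum_(0 <= n < N) u n : K^o).

Lemma norm_limn_le (s : nat -> K^o) (c : K) :
  cvgn s -> (forall N, `|s N| <= c) -> `|limn s| <= c.
Proof.
move=> s_cvg s_le; apply/ler_addgt0Pr => e e0.
have /cvgrPdist_le/(_ _ e0) [N _ /(_ N (leqnn N)) /= sN] : s @ \oo --> limn s by [].
rewrite -[limn s](subrK (s N)) (le_trans (ler_normD _ _))// addrC.
exact: lerD.
Qed.

Lemma sum_half_le N : \sum_(0 <= n < N) (2^-1 ^+ n : K) <= 2.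
Proof.
suff -> : \sum_(0 <= n < N) (2^-1 ^+ n : K) = 2 - 2 * 2^-1 ^+ N.
  by rewrite gerBl mulr_ge0 ?exprn_ge0 ?invr_ge0 ?ler0n.
elim: N => [|N IHN]; first by rewrite big_nil expr0 mulr1 subrr.
by rewrite big_nat_recr //= IHN exprS; field.
Qed.

Variable m : nat -> K.
Hypothesis m_le : forall n, `|m n| <= 4%:R ^+ n.

(** With coefficients [m], the shift [k = 1] gives [G] and [k = 0] gives [zG]; with coefficients
    [n * m n], [k = 1] gives minus the derivative of [zG]. *)
Definition laurent_partial (k : nat) (c : nat -> K) (z : K) (N : nat) : K^o :=
  \sum_(0 <= n < N) c n / z ^+ (n + k).

Lemma norm_inv_le (z : K) : 16%:R < `|z| -> z != 0 /\ `|z^-1| <= 16%:R^-1.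
Proof.
move=> z16; have z0 : 0 < `|z| by apply: lt_trans z16; rewrite ltr0n.
split; first by rewrite -normr_gt0.
by rewrite normfV lef_pV2 ?posrE ?ltr0n// ltW.
Qed.

(** The factor [2 ^ n] leaves room for coefficients [n * m n]; since [2 * 4 / 16 = 1 / 2], the terms
    are dominated by a geometric series. *)
Lemma cvg_laurent k (c : nat -> K) (b : K) z : 16%:R < `|z| ->
  (forall n, `|c n| <= b * 2%:R ^+ n * 4%:R ^+ n) -> cvgn (laurent_partial k c z).
Proof.
move=> /norm_inv_le[z0 z_le] c_le; apply: (@cvg_dominated _ b) => n.
have b0 : 0 <= b by have := c_le 0%N; rewrite !expr0 !mulr1; apply: le_trans.
rewrite normrM -exprVn normrX exprD mulrA.
have zk : `|z^-1| ^+ k <= 1.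
  by apply: exprn_ile1 => //; apply: le_trans z_le _; rewrite invf_le1 ?ltr0n// ler1n.
have cz : `|c n| * `|z^-1| ^+ n <= b * 2%:R ^+ n * 4%:R ^+ n * 16%:R^-1 ^+ n.
  by rewrite ler_pM ?exprn_ge0// lerXn2r ?nnegrE ?invr_ge0.
apply: le_trans (ler_pM _ _ cz zk) _; rewrite ?mulr_ge0 ?exprn_ge0//.
rewrite mulr1 -!mulrA ler_wpM2l// -!exprMn.
rewrite (_ : 2%:R * (4%:R * 16%:R^-1) = 2^-1 :> K) //.
by field.
Qed.

Lemma natr_le_exp2 n : (n%:R : K) <= 2%:R ^+ n.
Proof. by rewrite -natrX ler_nat ltnW// ltn_expl. Qed.

(* The second-order Taylor remainder of w |-> w^-n at z. *)
Lemma norm_inv_taylor_le n (z h : K) : 16%:R < `|z| -> 16%:R < `|z + h| ->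
  `|(z + h)^-1 ^+ n - z^-1 ^+ n + h * n%:R * z^-1 ^+ n.+1| <=
  `|h| ^+ 2 * 8%:R^-1 ^+ n.
Proof.
move=> /norm_inv_le[z0 v_le] /norm_inv_le[zh0 v'_le].
elim: n => [|n IHn].
  by rewrite !expr0 subrr mulr0 mul0r add0r normr0 mulr1 exprn_ge0.
(* With [v = 1 / z] and [v' = 1 / (z + h)] this follows from [v' - v = - h v v']. Each summand is at
   most [|h|^2 8^-n / 16], the second because [n + 1 <= 2 ^ n]; together they give the bound at
   [n + 1]. *)
have -> : (z + h)^-1 ^+ n.+1 - z^-1 ^+ n.+1 + h * n.+1%:R * z^-1 ^+ n.+2 =
    (z + h)^-1 * ((z + h)^-1 ^+ n - z^-1 ^+ n + h * n%:R * z^-1 ^+ n.+1) +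
    h ^+ 2 * (n.+1%:R * z^-1 ^+ n) * (z^-1 ^+ 2 * (z + h)^-1).
  rewrite -natr1 !exprS expr0; move: (z^-1 ^+ n) ((z + h)^-1 ^+ n) => x y.
  by field; rewrite z0 zh0.
set r := (X in (z + h)^-1 * X); rewrite -/r in IHn.
have t0 : 0 <= 16%:R^-1 :> K by rewrite invr_ge0 ler0n.
have A1 : `|(z + h)^-1 * r| <= 16%:R^-1 * (`|h| ^+ 2 * 8%:R^-1 ^+ n).
  by rewrite normrM ler_pM.
have A2 : `|h ^+ 2 * (n.+1%:R * z^-1 ^+ n) * (z^-1 ^+ 2 * (z + h)^-1)| <=
    `|h| ^+ 2 * 8%:R^-1 ^+ n * 16%:R^-1.
  rewrite normrM [in leLHS]normrM normrX ler_pM ?mulr_ge0 ?exprn_ge0//.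
    rewrite ler_wpM2l ?exprn_ge0// normrM normr_nat normrX.
    apply: (@le_trans _ _ (2%:R ^+ n * 16%:R^-1 ^+ n)); last first.
      by rewrite -exprMn (_ : 2%:R / 16%:R = 8%:R^-1 :> K) //; field.
    rewrite ler_pM ?exprn_ge0 ?lerXn2r ?nnegrE//.
    by rewrite -natrX ler_nat ltn_expl.
  rewrite normrM normrX -[leRHS]mul1r ler_pM ?exprn_ge0//.
  apply: exprn_ile1 => //; apply: le_trans v_le _.
  by rewrite invf_le1 ?ltr0n// ler1n.
apply: le_trans (ler_normD _ _) _; apply: le_trans (lerD A1 A2) _.
rewrite le_eqVlt; apply/orP; left; apply/eqP; rewrite [8%:R^-1 ^+ n.+1]exprS.
by move: (8%:R^-1 ^+ n) => x; field.
Qed.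

Definition laurent (z : K) : K^o := limn (laurent_partial 1 m z).

Lemma cvg_laurent_m k z : 16%:R < `|z| -> cvgn (laurent_partial k m z).
Proof.
move=> z16; apply: (@cvg_laurent _ _ 1) => // n; rewrite mul1r.
apply: le_trans (m_le n) _; rewrite ler_peMl ?exprn_ge0 ?ler0n//.
by rewrite exprn_ege1// ler1n.
Qed.

Lemma cvg_laurent_nm k z : 16%:R < `|z| ->
  cvgn (laurent_partial k (fun n => n%:R * m n) z).
Proof.
move=> z16; apply: (@cvg_laurent _ _ 1) => // n; rewrite mul1r normrM normr_nat.
by rewrite ler_pM// natr_le_exp2.
Qed.

Lemma is_cvg_mull (c : K) (s : nat -> K^o) : cvgn s ->
  cvgn (fun N => c * s N : K^o).
Proof. by move=> s_cvg; apply: is_cvgM => //; exact: is_cvg_cst. Qed.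

Lemma limn_mull (c : K) (s : nat -> K^o) : cvgn s ->
  limn (fun N => c * s N : K^o) = c * limn s.
Proof. by move=> s_cvg; apply/cvg_lim => //; apply: cvgM => //; exact: cvg_cst. Qed.

Lemma mul_laurent z : 16%:R < `|z| -> z * laurent z = limn (laurent_partial 0 m z).
Proof.
move=> z16; have [z0 _] := norm_inv_le z16.
rewrite /laurent -limn_mull; last exact: cvg_laurent_m.
congr (lim (_ @ \oo)); apply/funext => N; rewrite /laurent_partial mulr_sumr.
apply: eq_bigr => n _; rewrite addn0 addn1 exprS; field.
by rewrite z0 expf_neq0.
Qed.

(** The termwise remainders are at most [|h|^2 (4 / 8)^n], with sum at most [2 |h|^2]. This
    quadratic estimate justifies termwise differentiation directly. *)
Lemma laurent_taylor z h : 16%:R < `|z| -> 16%:R < `|z + h| ->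
  `|(z + h) * laurent (z + h) - z * laurent z +
    h * limn (laurent_partial 1 (fun n => n%:R * m n) z)| <= 2 * `|h| ^+ 2.
Proof.
move=> z16 zh16; rewrite !mul_laurent//.
pose s N := laurent_partial 0 m (z + h) N - laurent_partial 0 m z N +
   h * laurent_partial 1 (fun n => n%:R * m n) z N.
have s_cvg : (s : nat -> K^o) @ \oo --> (limn (laurent_partial 0 m (z + h)) -
    limn (laurent_partial 0 m z) +
    h * limn (laurent_partial 1 (fun n => n%:R * m n) z) : K^o).
  apply: cvgD; first by apply: cvgB; exact: cvg_laurent_m.
  by apply: cvgM; [exact: cvg_cst|exact: cvg_laurent_nm].
rewrite -(cvg_lim _ s_cvg)//; apply: norm_limn_le; first by apply: cvgP s_cvg.
move=> N; have -> : s N = \sum_(0 <= n < N) m n *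
    ((z + h)^-1 ^+ n - z^-1 ^+ n + h * n%:R * z^-1 ^+ n.+1).
  rewrite /s /laurent_partial mulr_sumr -sumrB -big_split /=; apply: eq_bigr => n _.
  by rewrite addn0 addn1 !exprVn; ring.
apply: le_trans (ler_norm_sum _ _ _) _.
apply: (@le_trans _ _ (\sum_(0 <= n < N) `|h| ^+ 2 * 2^-1 ^+ n)).
  apply: ler_sum => n _; rewrite normrM.
  apply: le_trans (ler_pM _ _ (m_le n) (norm_inv_taylor_le n z16 zh16)) _ => //.
  rewrite mulrCA ler_wpM2l ?exprn_ge0// -exprMn (_ : 4%:R / 8%:R = 2^-1 :> K) //.
  by field.
by rewrite -mulr_sumr mulrC ler_wpM2r ?exprn_ge0 ?sum_half_le.
Qed.

Lemma is_derive_mul_laurent (z : K) : 16%:R < `|z| ->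
  is_derive (z : K^o) 1 (fun w : K^o => w * laurent w : K^o)
    (- limn (laurent_partial 1 (fun n => n%:R * m n) z)).
Proof.
move=> z16; set L := limn _.
suff d_cvg : (fun h : K^o => h^-1 *:
     (((fun w : K^o => w * laurent w : K^o) \o shift (z : K^o)) (h *: 1) -
     z * laurent z) : K^o) @ 0^' --> (- L : K^o).
  by split; [apply: cvgP d_cvg | apply: cvg_lim d_cvg].
apply/cvgrPdist_le => e e0.
have e20 : 0 < e / 2 by rewrite divr_gt0 ?ltr0n.
have z160 : 0 < `|z| - 16%:R by rewrite subr_gt0.
near=> h.
have h0 : h != 0 by near: h; exact: nbhs_dnbhs_neq.
(* This turns the quotient bound [2 |h|] into [e]; the next condition on [h] keeps [z + h] outside
   the disc of radius 16. *)
have h_e : `|h| <= e / 2.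
  by near: h; apply: dnbhs0_le.
have h_z : `|h| < `|z| - 16%:R.
  by near: h; apply: dnbhs0_lt.
have zh16 : 16%:R < `|z + h|.
  apply: (@lt_le_trans _ _ (`|z| - `|h|)); first by rewrite ltrBrDr addrC -ltrBrDr.
  by rewrite lerBlDr -{1}(addrK h z) (le_trans (ler_normB _ _)).
have := laurent_taylor z16 zh16; rewrite -/L /= => T.
rewrite -[h *: 1]/(h * 1) mulr1 [h + z]addrC.
rewrite (_ : - L - _ = - (h^-1 * ((z + h) * laurent (z + h) - z * laurent z + h * L))).
  rewrite normrN normrM normfV mulrC ler_pdivrMr ?normr_gt0//.
  apply: le_trans T _; rewrite expr2 mulrA ler_wpM2r//.
  by rewrite mulrC -ler_pdivlMr ?ltr0n.
rewrite -[h^-1 *: _]/(h^-1 * _); field.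
by [].
Unshelve. all: by end_near. Qed.

End LaurentSeries.

(** * The complex case *)

Section ComplexSequences.
Variable R : realType.

Lemma complex_gt0 (e : R[i]) : 0 < e -> exists2 r : R, 0 < r & e = r%:C%C.
Proof.
move=> e0; exists (complex.Re e); first by move: e0; rewrite ltcE => /andP[].
by rewrite RRe_real// gtr0_real.
Qed.

Lemma cvg_invn_complex : (fun N : nat => (N%:R^-1 : R[i]^o)) @ \oo --> (0 : R[i]^o).
Proof.
apply/cvgr0Pnorm_lt => _ /complex_gt0[r r0 ->].
have := nbhs_infty_gtr r^-1; apply: filterS => N rN.
have N0 : 0 < N%:R :> R by apply: lt_trans rN; rewrite invr_gt0.
rewrite normfV normr_nat -(rmorph_nat (real_complex R)) -fmorphV ltcR.
by rewrite invf_plt ?posrE.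
Qed.

Lemma norm_Im_le (x : R[i]) : `|complex.Im x|%:C%C <= `|x|.
Proof.
rewrite normc_def lecR -sqrtr_sqr ler_wsqrtr// lerDr.
by rewrite sqr_ge0.
Qed.

Lemma norm_complex_le (x : R[i]) : `|x| <= (`|complex.Re x| + `|complex.Im x|)%:C%C.
Proof.
rewrite normc_def lecR -[leRHS]ger0_norm ?addr_ge0// -sqrtr_sqr ler_wsqrtr//.
rewrite sqrrD !real_normK ?num_real// -addrA lerD2l lerDr.
by rewrite mulrn_wge0 ?mulr_ge0.
Qed.

Lemma cvg_complex (u v : nat -> R) (x y : R) :
  u @ \oo --> x -> v @ \oo --> y ->
  (fun N => (u N +i* v N)%C : R[i]^o) @ \oo --> ((x +i* y)%C : R[i]^o).
Proof.
move=> ux vy; apply/cvgrPdist_lt => _ /complex_gt0[r r0 ->].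
have r20 : 0 < r / 2 by rewrite divr_gt0.
have /cvgrPdist_lt/(_ _ r20) ux' := ux.
have /cvgrPdist_lt/(_ _ r20) vy' := vy.
near=> N; apply: le_lt_trans (norm_complex_le _) _ => /=.
rewrite ltcR [ltRHS](splitr r) ltrD//.
- by near: N.
- by near: N.
Unshelve. all: by end_near. Qed.

(** Real and imaginary parts converge absolutely by comparison with a real geometric series; the
    bound at [n = 0] makes [c] nonnegative, hence real. *)
Lemma cvg_dominated_complex (u : nat -> R[i]) (c : R[i]) :
  (forall n, `|u n| <= c * 2^-1 ^+ n) ->
  cvgn (fun N => \sum_(0 <= n < N) u n : R[i]^o).
Proof.
move=> u_le; have c0 : 0 <= c.
  by have := u_le 0%N; rewrite expr0 mulr1; apply: le_trans.
have cE : c = (complex.Re c)%:C%C by rewrite RRe_real// ger0_real.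
have real_cvg (w : nat -> R) : (forall n, `|w n|%:C%C <= `|u n|) -> cvgn (series w).
  move=> w_le; apply: normed_cvg.
  apply: (@series_le_cvg _ _ (geometric (complex.Re c) 2^-1)) => [n||n|] /=.
  - exact: normr_ge0.
  - by move=> n; rewrite mulr_ge0 ?exprn_ge0 ?invr_ge0// -lecR -cE.
  - rewrite -lecR; apply: le_trans (w_le n) _; apply: le_trans (u_le n) _.
    by rewrite [X in X * _ <= _]cE rmorphM rmorphXn /= fmorphV rmorph_nat.
  - apply: is_cvg_geometric_series.
    by rewrite ger0_norm ?invr_ge0// invf_lt1// ltr1n.
have Re_cvg := real_cvg (fun n => complex.Re (u n)) (fun n => normc_ge_Re (u n)).
have Im_cvg := real_cvg (fun n => complex.Im (u n)) (fun n => norm_Im_le (u n)).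
rewrite (_ : (fun N => _) = (fun N => (series (fun n => complex.Re (u n)) N +i*
    series (fun n => complex.Im (u n)) N)%C : R[i]^o)).
  by apply: cvgP; exact: cvg_complex Re_cvg Im_cvg.
apply/funext => N; rewrite /series /=.
elim: N => [|N IHN]; first by rewrite !big_nil.
by rewrite !big_nat_recr //= IHN; case: (u N).
Qed.

End ComplexSequences.

(** * From independence to the relation between the transforms *)

Lemma inf_independent_clt (R : realType) (A : algType R[i])
    (phi phi' : {scalar A}) (a : A) (a_ : nat -> A) (alpha : R[i])
    (phi1 : phi 1 = 1) (phi'1 : phi' 1 = 0)
    (a_id : identically_distributed phi phi' a a_)
    (a_indep : inf_independent phi phi' a_)
    (phi_a : phi a = 0) (phi'_a : phi' a = 0)
    (phi_a2 : phi (a ^+ 2) = 1) (phi'_a2 : phi' (a ^+ 2) = alpha) :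
  clt_functionals alpha (word_moment a_ phi) (word_moment a_ phi').
Proof.
case: a_indep => ind.
- exact: free_clt ind _ _ _ _ _.
- exact: boolean_clt ind _ _ _ _ _.
- exact: monotone_clt ind _ _ _ _ _.
Qed.

Lemma clt_moment_words (R : realType) (A : algType R[i]) (psi : {scalar A})
    (a_ : nat -> A) n N :
  clt_moment psi a_ n N = (sqrtC (N%:R : R[i]))^-1 ^+ n *
    \sum_(t : n.-tuple 'I_N) word_moment a_ psi (word t).
Proof.
rewrite /clt_moment /clt_sum exprZn exp_sum_words linearZ /= linear_sum.
by [].
Qed.

Theorem proposition5p4 (R : realType) (A : algType R[i])
    (phi phi' : {scalar A}) (a : A) (a_ : nat -> A) (alpha : R[i])
    (phi1 : phi 1 = 1) (phi'1 : phi' 1 = 0)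
    (a_id : identically_distributed phi phi' a a_)
    (a_indep : inf_independent phi phi' a_)
    (phi_a : phi a = 0) (phi'_a : phi' a = 0)
    (phi_a2 : phi (a ^+ 2) = 1) (phi'_a2 : phi' (a ^+ 2) = alpha) :
  let m := limit_moment phi a_ in
  let m' := limit_moment phi' a_ in
  let G := cauchy_transform m in
  let g := inf_cauchy_transform m' in
  (forall n, cvgn (clt_moment phi a_ n) /\ cvgn (clt_moment phi' a_ n)) /\
  exists rho : R, forall z : R[i], rho%:C%C < `|z| ->
    [/\ cvgn (cauchy_partial m z),
        cvgn (inf_cauchy_partial m' z),
        derivable (fun w : R[i]^o => (w * G w : R[i]^o)) z 1 &
        g z = - alpha / 2 * derive1 (fun w : R[i]^o => (w * G w : R[i]^o)) z].
Proof.
move=> m m' G g.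
have clt := inf_independent_clt phi1 phi'1 a_id a_indep phi_a phi'_a phi_a2 phi'_a2.
have [p_spread q_spread] := clt_spread clt.
have cvg_mom (psi : {scalar A}) n : spreadable (word_moment a_ psi) ->
    (forall k, (n < k.*2)%N -> onto_sum (word_moment a_ psi) n k = 0) ->
    clt_moment psi a_ n @ \oo --> (clt_limit (word_moment a_ psi) n : R[i]^o).
  move=> psi_spread onto0.
  rewrite (_ : clt_moment psi a_ n = fun N => (sqrtC (N%:R : R[i]))^-1 ^+ n *
    \sum_(t : n.-tuple 'I_N) word_moment a_ psi (word t)); last first.
    by apply/funext => N; exact: clt_moment_words.
  exact: (cvg_clt_words (@cvg_invn_complex R) psi_spread onto0).
have cvg_p n := cvg_mom phi n p_spread (fun k nk => (onto_sum_singleton clt nk).1).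
have cvg_q n := cvg_mom phi' n q_spread (fun k nk => (onto_sum_singleton clt nk).2).
have mE n : m n = clt_limit (word_moment a_ phi) n by apply: cvg_lim (cvg_p n).
(* For odd [n] both limits vanish; for [n = 2k] this is [onto_sum_pairs] divided by [k!]. *)
have m'E n : m' n = alpha / 2 * (n%:R * m n).
  rewrite mE; have -> : m' n = clt_limit (word_moment a_ phi') n.
    by apply: cvg_lim (cvg_q n).
  rewrite /clt_limit; case: ifPn => n_odd; first by rewrite !mulr0.
  have nE : n./2.*2 = n by rewrite -[RHS]odd_double_half (negbTE n_odd).
  have := onto_sum_pairs clt n./2; rewrite nE => ->.
  by rewrite -[in n%:R]nE -muln2 natrM; field; rewrite pnatr_eq0 -lt0n fact_gt0.
have m_le n : `|m n| <= 4%:R ^+ n.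
  rewrite mE /clt_limit; case: ifPn => n_odd; first by rewrite normr0 exprn_ge0.
  have nE : n./2.*2 = n by rewrite -[RHS]odd_double_half (negbTE n_odd).
  have := norm_onto_sum_pairs clt n./2; rewrite nE => /le_trans; apply.
  by rewrite -[in leRHS]nE -mul2n exprM -[4%:R ^+ 2]natrX lexx.
split; first by move=> n; split; [exact: cvgP (cvg_p n) | exact: cvgP (cvg_q n)].
exists 16%:R => z; rewrite rmorph_nat => z16.
have dom := @cvg_dominated_complex R.
have cauchyE w : cauchy_partial m w = laurent_partial 1 m w.
  by apply/funext => N; apply: eq_bigr => n _; rewrite addn1.
have GE : G = laurent m by apply/funext => w; rewrite /G /cauchy_transform cauchyE.
have inf_cauchyE : inf_cauchy_partial m' z =
    (fun N => alpha / 2 * laurent_partial 1 (fun n => n%:R * m n) z N : R[i]^o).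
  apply/funext => N; rewrite /laurent_partial mulr_sumr.
  case: N => [|N]; first by rewrite /inf_cauchy_partial !big_geq.
  (* The [n = 0] term is zero because of the factor [n], so starting the infinitesimal series at 1
     loses nothing. *)
  rewrite [RHS]big_ltn // mul0r mul0r mulr0 add0r.
  by apply: eq_bigr => n _; rewrite m'E addn1 -!mulrA.
have D := is_derive_mul_laurent dom m_le z16.
have cvg_n := cvg_laurent_nm dom m_le (k := 1) z16.
split.
- by rewrite cauchyE; exact: (cvg_laurent_m dom m_le (k := 1) z16).
- rewrite inf_cauchyE; exact: is_cvg_mull cvg_n.
- by rewrite GE; case: D.
- rewrite derive1E GE (@derive_val _ _ _ _ _ _ _ D) /g /inf_cauchy_transform inf_cauchyE.
  by rewrite limn_mull // mulNr mulrNN.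
Qed.
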